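(* Let $R$ be a commutative ring and let $a,b,c,d\in R$. Suppose that the Koszul complexes $$R\xrightarrow{\ \partial_2=\binom{b}{-a}\ }R\oplus R\xrightarrow{\ \partial_1=(a\ \ b)\ }R\qquad\text{and}\qquad R\xrightarrow{\ \sigma_2=\binom{d}{-c}\ }R\oplus R\xrightarrow{\ \sigma_1=(c\ \ d)\ }R$$ are exact, i.e. $\operatorname{im}\partial_2=\ker\partial_1$ and $\operatorname{im}\sigma_2=\ker\sigma_1$. Consider the complexes obtained by replacing $R$ with $R/(c,d)$ and $R/(a,b)$, respectively: $$\frac{R}{(c,d)}\xrightarrow{\ \tilde\partial_2=\binom{b}{-a}\ }\frac{R}{(c,d)}\oplus\frac{R}{(c,d)}\xrightarrow{\ \tilde\partial_1=(a\ \ b)\ }\frac{R}{(c,d)}$$ and $$\frac{R}{(a,b)}\xrightarrow{\ \tilde\sigma_2=\binom{d}{-c}\ }\frac{R}{(a,b)}\oplus\frac{R}{(a,b)}\xrightarrow{\ \tilde\sigma_1=(c\ \ d)\ }\frac{R}{(a,b)}.$$ Then the homologies $$H(a,b;c,d)=\ker\tilde\partial_1/\operatorname{im}\tilde\partial_2\qquad\text{and}\qquad H(c,d;a,b)=\ker\tilde\sigma_1/\operatorname{im}\tilde\sigma_2$$ are isomorphic as $R$-modules.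
   Context: Exactness means exactness at the middle term only. A column $\binom{p}{q}$ denotes the map $r\mapsto(pr,qr)$, and a row $(p\ \ q)$ denotes the map $(u,v)\mapsto pu+qv$. The maps with tildes are given by the same matrices as the maps without tildes, acting over the indicated quotient rings. $(c,d)$ and $(a,b)$ in the quotients denote the ideals of $R$ generated by these elements. *)

(* Defs.v *)
From HB Require Import structures.
From mathcomp Require Import all_boot all_algebra boolp.

Set Implicit Arguments.
Unset Strict Implicit.
Unset Printing Implicit Defensive.

Import GRing.Theory.
Local Open Scope ring_scope.
Local Open Scope quotient_scope.

Section QuotientModule.
Variables (R : pzRingType) (V : lmodType R) (S : submodClosed V).

(* submodClosed also covers semimodules and so does not provide closure under
   opposite, which Quotient.quot requires. *)
Definition zmod_of_submod : {pred V} := S.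

Fact zmod_of_submod_closed : zmod_closed zmod_of_submod.
Proof.
split=> [|x y]; first exact: (rpred0 S).
by move=> Sx Sy; rewrite -scaleN1r; apply: (rpredD Sx); apply: rpredZ.
Qed.

HB.instance Definition _ :=
  GRing.isZmodClosed.Build V zmod_of_submod zmod_of_submod_closed.

Definition quotmod := Quotient.quot zmod_of_submod.

HB.instance Definition _ := GRing.Zmodule.on quotmod.
HB.instance Definition _ := Quotient.on quotmod.

Definition quotmod_scale (r : R) (x : quotmod) : quotmod :=
  \pi_quotmod (r *: repr x).

Lemma pi_quotmod_eq (x y : V) :
  (\pi_quotmod x = \pi_quotmod y) <-> (x - y \in S).
Proof.
rewrite -[x - y \in S]/(x - y \in zmod_of_submod) Quotient.idealrBE.
by split=> /eqP.
Qed.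

Lemma pi_quotmodD (x y : V) :
  \pi_quotmod (x + y) = \pi_quotmod x + \pi_quotmod y.
Proof. exact: (raddfD (\pi_quotmod)). Qed.

Lemma quotmod_scaleE r (x : V) :
  quotmod_scale r (\pi_quotmod x) = \pi_quotmod (r *: x).
Proof.
apply/pi_quotmod_eq; rewrite -scalerBr; apply: rpredZ.
by apply/pi_quotmod_eq; rewrite reprK.
Qed.

Fact quotmod_scaleA r s x :
  quotmod_scale r (quotmod_scale s x) = quotmod_scale (r * s) x.
Proof. by rewrite -[x]reprK !quotmod_scaleE scalerA ?reprK. Qed.

Fact quotmod_scale1 : left_id 1 quotmod_scale.
Proof. by move=> x; rewrite -[x]reprK quotmod_scaleE scale1r. Qed.

Fact quotmod_scaleDr : right_distributive quotmod_scale +%R.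
Proof.
move=> r x y; rewrite -[x]reprK -[y]reprK -pi_quotmodD !quotmod_scaleE.
by rewrite scalerDr pi_quotmodD.
Qed.

Fact quotmod_scaleDl x : {morph quotmod_scale^~ x : r s / r + s}.
Proof.
by move=> r s; rewrite -[x]reprK !quotmod_scaleE scalerDl pi_quotmodD.
Qed.

HB.instance Definition _ := GRing.Zmodule_isLmodule.Build R quotmod
  quotmod_scaleA quotmod_scale1 quotmod_scaleDr quotmod_scaleDl.

End QuotientModule.

Section KernelImage.
Variables (R : pzRingType) (U V : lmodType R) (f : {linear U -> V}).

Definition lker_pred : {pred U} := fun u => f u == 0.

Fact lker_submod_closed : submod_closed lker_pred.
Proof.
split=> [|r u v]; rewrite !unfold_in ?linear0 // => /eqP fu /eqP fv.
by rewrite linearP fu fv scaler0 addr0.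
Qed.

HB.instance Definition _ :=
  GRing.isSubmodClosed.Build R U lker_pred lker_submod_closed.

Definition lim_pred : {pred V} := fun v => `[< exists u, f u = v >].

Fact lim_submod_closed : submod_closed lim_pred.
Proof.
split=> [|r u v]; rewrite !unfold_in.
  by apply/asboolP; exists 0; rewrite linear0.
move=> /asboolP[x <-] /asboolP[y <-]; apply/asboolP; exists (r *: x + y).
by rewrite linearP.
Qed.

HB.instance Definition _ :=
  GRing.isSubmodClosed.Build R V lim_pred lim_submod_closed.

Definition lker_mod := {u : U | u \in lker_pred}.

HB.instance Definition _ := SubChoice.on lker_mod.
HB.instance Definition _ := [SubChoice_isSubLmodule of lker_mod by <:].

End KernelImage.

Section Homology.
Variables (R : pzRingType) (U V W : lmodType R).
Variables (f : {linear U -> V}) (g : {linear V -> W}).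

Definition exact_at : Prop := lim_pred f =i lker_pred g.

(* im f pulled back to ker g: this is all of im f when g \o f = 0, so that
   the homology below is ker g / im f for a complex. *)
Definition lim_in_ker : {pred lker_mod g} := fun x => val x \in lim_pred f.

Fact lim_in_ker_submod_closed : submod_closed lim_in_ker.
Proof.
split=> [|r u v]; rewrite !unfold_in ?linear0.
  exact: (rpred0 (lim_pred f)).
by move=> fu fv; rewrite linearP; apply: (lim_submod_closed f).2.
Qed.

HB.instance Definition _ :=
  GRing.isSubmodClosed.Build R (lker_mod g) lim_in_ker lim_in_ker_submod_closed.

Definition homology := quotmod lim_in_ker.
HB.instance Definition _ := GRing.Lmodule.on homology.
HB.instance Definition _ := Quotient.on homology.

End Homology.

Section Koszul.
Variables (R : comPzRingType) (a b : R) (M : lmodType R).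

Definition koszul2 (r : M) : M * M := (b *: r, - a *: r).

Fact koszul2_linear : linear koszul2.
Proof.
move=> r u v; rewrite /koszul2; congr (_, _); rewrite /= !scalerDr !scalerA;
by rewrite mulrC.
Qed.

HB.instance Definition _ :=
  GRing.isLinear.Build R M (M * M)%type *:%R koszul2 koszul2_linear.

Definition koszul1 (x : M * M) : M := a *: x.1 + b *: x.2.

Fact koszul1_linear : linear koszul1.
Proof.
move=> r u v; rewrite /koszul1 /= !scalerDr !scalerA.
by rewrite addrACA [a * r]mulrC [b * r]mulrC.
Qed.

HB.instance Definition _ :=
  GRing.isLinear.Build R (M * M)%type M *:%R koszul1 koszul1_linear.

Lemma koszul12 (r : M) : koszul1 (koszul2 r) = 0.
Proof.
by rewrite /koszul1 /koszul2 /= !scalerA mulrN mulrC scaleNr subrr.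
Qed.

End Koszul.

Section Ideal2.
Variables (R : comPzRingType) (c d : R).

Definition ideal2 : {pred R^o} := fun r => `[< exists x y, r = x * c + y * d >].

Fact ideal2_submod_closed : submod_closed ideal2.
Proof.
split=> [|r u v]; rewrite !unfold_in.
  by apply/asboolP; exists 0, 0; rewrite !mul0r addr0.
move=> /asboolP[x [y ->]] /asboolP[z [t ->]]; apply/asboolP.
exists (r * x + z), (r * y + t).
by rewrite /GRing.scale /= mulrDr !mulrDl !mulrA addrACA.
Qed.

HB.instance Definition _ :=
  GRing.isSubmodClosed.Build R R^o ideal2 ideal2_submod_closed.

End Ideal2.

(* H(a, b; c, d): R/(c, d) is taken as an R-module, on which a scalar acts as
   multiplication by its residue class (quotmod_scaleE). *)
Definition koszul_homology (R : comPzRingType) (a b c d : R) : lmodType R :=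
  homology (koszul2 a b (M := quotmod (ideal2 c d)))
           (koszul1 a b (M := quotmod (ideal2 c d))).

(* Main.v *)
(** The isomorphism sends the class of [(p, q)] to the class of [(x, y)]
    whenever [a p + b q = c x + d y]. For given [(p, q)], exactness of the second
    Koszul complex makes [(x, y)] unique up to [im sigma_2]; changing [p] and [q]
    by elements of [(c, d)] changes [x] and [y] by elements of [(a, b)], and
    changing [(p, q)] by an element of [im partial_2] does not change
    [a p + b q]. The correspondence is symmetric in the two complexes, so it is
    bijective. *)
Require Import Defs.
From mathcomp Require Import all_boot all_algebra.
From mathcomp Require Import boolp ring.
From HB Require Import structures.
Import GRing.Theory.
Local Open Scope ring_scope.
Local Open Scope quotient_scope.

(** Subtracting related pairs turns the two conditions at [0] into uniqueness of partners on both
    sides, so functions chosen from totality in each direction are mutually inverse. *)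
Lemma linear_bijection_of_rel (R : pzRingType) (U V : lmodType R)
    (rel : U -> V -> Prop) :
  (forall r u u' v v', rel u v -> rel u' v' -> rel (r *: u + u') (r *: v + v')) ->
  (forall u, exists v, rel u v) -> (forall v, exists u, rel u v) ->
  (forall v, rel 0 v -> v = 0) -> (forall u, rel u 0 -> u = 0) ->
  exists phi : {linear U -> V}, bijective phi.
Proof.
move=> lin totl totr funl funr.
have [f fP] := choice totl; have [g gP] := choice totr.
have lin_sub u u' v v' : rel u v -> rel u' v' -> rel (u - u') (v - v').
  by move=> h h'; have := lin (-1) _ _ _ _ h' h; rewrite !scaleN1r ![- _ + _]addrC.
have uniql u v v' : rel u v -> rel u v' -> v = v'.
  by move=> h h'; apply/subr0_eq/funl; rewrite -(subrr u); apply: lin_sub.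
have uniqr u u' v : rel u v -> rel u' v -> u = u'.
  by move=> h h'; apply/subr0_eq/funr; rewrite -(subrr v); apply: lin_sub.
have f_linear : linear f.
  by move=> r u v; apply: uniql (fP _) _; apply: lin.
pose L := GRing.isLinear.Build R U V *:%R f f_linear.
pose phi : {linear U -> V} := HB.pack f L.
exists phi; exists g => [u|v]; first exact: uniqr (gP _) (fP _).
exact: uniql (fP _) (gP _).
Qed.

Lemma ideal2P (R : comPzRingType) (c d r : R) :
  reflect (exists x y, r = x * c + y * d) (r \in ideal2 c d).
Proof. exact: asboolP. Qed.

Lemma pi_ideal2_eq (R : comPzRingType) (c d p q : R) :
  \pi_(quotmod (ideal2 c d)) p = \pi_(quotmod (ideal2 c d)) q <->
  exists x y, p = q + (x * c + y * d).
Proof.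
rewrite pi_quotmod_eq; split=> [/ideal2P[x [y e]]|[x [y ->]]].
  by exists x, y; rewrite -e addrC subrK.
by apply/ideal2P; exists x, y; rewrite addrC addKr.
Qed.

Lemma scale_pi_quotmod (R : pzRingType) (V : lmodType R) (S : submodClosed V)
    (r : R) (x : V) : r *: \pi_(quotmod S) x = \pi_(quotmod S) (r *: x).
Proof. exact: quotmod_scaleE. Qed.

Lemma pi_homology_eq0 {R : pzRingType} {U V W : lmodType R}
    {f : {linear U -> V}} {g : {linear V -> W}} (z : lker_mod g) :
  \pi_(homology f g) z = 0 <-> val z \in lim_pred f.
Proof.
by rewrite -(raddf0 (\pi_(quotmod (lim_in_ker f (g := g))))) pi_quotmod_eq subr0.
Qed.

(** A relation rather than a function of [p] and [q], because only pairs with [a * p + b * q] in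
    [(c, d)] have a homology class. *)
Definition represents {R : comPzRingType} {a b c d : R} (p q : R)
    (h : koszul_homology a b c d) : Prop :=
  exists2 z : lker_mod (koszul1 a b (M := quotmod (ideal2 c d))),
    \pi_(homology (koszul2 a b (M := quotmod (ideal2 c d)))
                  (koszul1 a b (M := quotmod (ideal2 c d)))) z = h
    & val z = (\pi_(quotmod (ideal2 c d)) p, \pi_(quotmod (ideal2 c d)) q).

Section Represents.
Context {R : comPzRingType} {a b c d : R}.
Implicit Types (p q x y r : R) (h : koszul_homology a b c d).
Local Notation Q := (quotmod (ideal2 c d)).
Local Notation piQ := (\pi_Q).

Lemma koszul1_pi p q : koszul1 a b (piQ p, piQ q) = piQ (a * p + b * q).
Proof. by rewrite /koszul1 /= !scale_pi_quotmod -pi_quotmodD. Qed.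

Lemma koszul2_pi p : koszul2 a b (piQ p) = (piQ (b * p), piQ (- a * p)).
Proof. by rewrite /koszul2 !scale_pi_quotmod. Qed.

Lemma koszul1_pi_eq0 p q :
  koszul1 a b (piQ p, piQ q) = 0 <->
  exists x y, a * p + b * q = c * x + d * y.
Proof.
rewrite koszul1_pi -(raddf0 piQ) pi_ideal2_eq.
by split=> -[x [y ->]]; exists x, y; rewrite add0r [c * x]mulrC [d * y]mulrC.
Qed.

Lemma represents_cycle h :
  exists p q x y, represents p q h /\ a * p + b * q = c * x + d * y.
Proof.
pose z := repr h; pose p := repr (val z).1; pose q := repr (val z).2.
have ez : val z = (piQ p, piQ q) by rewrite !reprK; case: (val z).
have /eqP := valP z; rewrite ez => /koszul1_pi_eq0[x [y exy]].
by exists p, q, x, y; split; [exists z => //; exact: reprK |].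
Qed.

Lemma represents_ex {p q x y} :
  a * p + b * q = c * x + d * y -> exists h, represents p q h.
Proof.
move=> e; have Hz : (piQ p, piQ q) \in lker_pred (koszul1 a b (M := Q)).
  by apply/eqP/koszul1_pi_eq0; exists x, y.
pose z : lker_mod (koszul1 a b (M := Q)) := @exist (Q * Q) _ _ Hz.
by eexists; exists z.
Qed.

Lemma represents_linear r {p q p' q' h h'} :
  represents p q h -> represents p' q' h' ->
  represents (r * p + p') (r * q + q') (r *: h + h').
Proof.
move=> [z <- ez] [z' <- ez']; exists (r *: z + z').
  by rewrite pi_quotmodD scale_pi_quotmod.
rewrite linearP /= ez ez' !pi_quotmodD.
(* Products in [R] are read as scalings of the regular module [R^o], which the projection
   respects. *)
by rewrite -[r * p]/(r *: (p : R^o)) -[r * q]/(r *: (q : R^o)) -!scale_pi_quotmod.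
Qed.

(** The boundary condition over [R/(c, d)] is lifted to [R]: [r] lifts a preimage under [koszul2],
    and the other four coefficients record the errors in [(c, d)]. *)
Lemma represents_eq0 {p q h} : represents p q h ->
  h = 0 <-> exists r s t u v,
    p = b * r + (s * c + t * d) /\ q = - a * r + (u * c + v * d).
Proof.
move=> [z <- ez].
apply: (iff_trans (pi_homology_eq0 z)); rewrite ez; split=> [/asboolP[r er]|[r [s [t [u [v [ep eq]]]]]]].
  have [] : (piQ (b * repr r), piQ (- a * repr r)) = (piQ p, piQ q).
    by rewrite -koszul2_pi reprK; exact: er.
  move=> /esym/pi_ideal2_eq[s [t ep]] /esym/pi_ideal2_eq[u [v eq]].
  by exists (repr r), s, t, u, v.
apply/asboolP; exists (piQ r); apply: etrans (koszul2_pi r) _.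
by congr (_, _); apply/esym/pi_ideal2_eq; [exists s, t | exists u, v].
Qed.

End Represents.

(** The graph of the isomorphism, phrased with lifts to [R] so that exchanging the two complexes
    only reverses the equation. *)
Definition koszul_rel {R : comPzRingType} {a b c d : R}
    (h : koszul_homology a b c d) (k : koszul_homology c d a b) : Prop :=
  exists p q x y, [/\ represents p q h, represents x y k
                    & a * p + b * q = c * x + d * y].

Lemma koszul_rel_sym {R : comPzRingType} {a b c d : R}
    {h : koszul_homology a b c d} {k : koszul_homology c d a b} :
  koszul_rel h k -> koszul_rel k h.
Proof. by move=> [p [q [x [y [hp hx e]]]]]; exists x, y, p, q. Qed.

Lemma koszul_rel_total {R : comPzRingType} {a b c d : R}
    (h : koszul_homology a b c d) : exists k, koszul_rel h k.
Proof.
have [p [q [x [y [hp e]]]]] := represents_cycle h.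
by have [k hk] := represents_ex (esym e); exists k, p, q, x, y.
Qed.

Lemma koszul_rel_linear {R : comPzRingType} {a b c d : R} (r : R)
    {h h' : koszul_homology a b c d} {k k' : koszul_homology c d a b} :
  koszul_rel h k -> koszul_rel h' k' -> koszul_rel (r *: h + h') (r *: k + k').
Proof.
move=> [p [q [x [y [hp hx e]]]]] [p' [q' [x' [y' [hp' hx' e']]]]].
exists (r * p + p'), (r * q + q'), (r * x + x'), (r * y + y').
split; [exact: represents_linear | exact: represents_linear |].
transitivity (r * (a * p + b * q) + (a * p' + b * q')); first by ring.
by rewrite e e'; ring.
Qed.

Lemma koszul_rel0 {R : comPzRingType} {a b c d : R}
    (k : koszul_homology c d a b) :
  exact_at (koszul2 c d (M := R^o)) (koszul1 c d (M := R^o)) ->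
  koszul_rel (0 : koszul_homology a b c d) k -> k = 0.
Proof.
move=> exact_cd [p [q [x [y [hp hx e]]]]].
have [r [s [t [u [v [ep eq]]]]]] := (represents_eq0 hp).1 erefl.
(* In [a * p + b * q] the terms in [r] cancel; the rest is regrouped by [c] and [d]. *)
have cycle : c * (x - (s * a + u * b)) + d * (y - (t * a + v * b)) = 0.
  transitivity (c * x + d * y - (a * p + b * q)); last by rewrite e subrr.
  by rewrite ep eq; ring.
have : (x - (s * a + u * b), y - (t * a + v * b))
    \in lker_pred (koszul1 c d (M := R^o)) by apply/eqP.
rewrite -exact_cd => /asboolP[w [ex ey]].
(* Exactness supplies [w]; regrouping has transposed the coefficient matrix, hence [u] before
   [t]. *)
apply/(represents_eq0 hx); exists w, s, u, t, v.
by rewrite [d * w]ex [- c * w]ey !subrK.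
Qed.

Theorem theorem5 (R : comPzRingType) (a b c d : R) :
  exact_at (koszul2 a b (M := R^o)) (koszul1 a b (M := R^o)) ->
  exact_at (koszul2 c d (M := R^o)) (koszul1 c d (M := R^o)) ->
  exists phi : {linear koszul_homology a b c d -> koszul_homology c d a b},
    bijective phi.
Proof.
move=> exact_ab exact_cd.
apply: (@linear_bijection_of_rel _ _ _ (@koszul_rel R a b c d)).
- by move=> r h h' k k'; apply: koszul_rel_linear.
- exact: koszul_rel_total.
- move=> k; have [h /koszul_rel_sym hk] := koszul_rel_total k; by exists h.
- by move=> k; apply: koszul_rel0.
(* With the complexes exchanged, injectivity rests on exactness of the complex of [a] and [b]. *)
- by move=> h /koszul_rel_sym; apply: koszul_rel0.
Qed.
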